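(* There exist absolute constants $C,c<\infty$ (independent of the depth of the tree, of $\mu$ and of $\delta$) such that for every finite bi-tree $T^2$, every non-negative function $\mu$ on $T^2$ with $|\mu|>0$, and every $\delta>0$: if $\mathcal{E}[\mu]\ge 2\delta|\mu|$, then $$\mathcal{E}_\delta[\mu]\le C\,\delta\,\exp\Bigl(c\sqrt{\log\frac{\mathcal{E}[\mu]}{\delta|\mu|}}\Bigr)\,|\mu|.$$
   Context: $T$ is a finite dyadic tree of arbitrary depth $N$: its nodes are the dyadic subintervals of $[0,1]$ of length $2^{-k}$, $0\le k\le N$, partially ordered by inclusion ($a'\ge a$ means that $a'\supseteq a$, i.e. $a'$ is an ancestor of $a$ or equals $a$). The bi-tree is $T^2=T\times T$ with the product partial order: $(\alpha_1',\alpha_2')\ge(\alpha_1,\alpha_2)$ iff $\alpha_1'\ge\alpha_1$ and $\alpha_2'\ge\alpha_2$. For $f:T^2\to\mathbb{R}$ put $$\mathbb{I}f(\alpha)=\sum_{\alpha'\ge\alpha}f(\alpha'),\qquad \mathbb{I}^*f(\alpha)=\sum_{\alpha'\le\alpha}f(\alpha').$$ A measure on $T^2$ is a non-negative function $\mu:T^2\to[0,\infty)$, and $|\mu|=\sum_{\alpha\in T^2}\mu(\alpha)$ is its total mass. Its potential is $\mathbb{V}^\mu=\mathbb{I}(\mathbb{I}^*\mu)$. For $s>0$ let $E_s=\{\alpha\in T^2:\mathbb{V}^\mu(\alpha)\le s\}$. The truncated potential is $\mathbb{V}^\mu_\delta=\mathbb{I}(\mathbf{1}_{E_\delta}\mathbb{I}^*\mu)$.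 The energy and truncated energy are $$\mathcal{E}[\mu]=\sum_{\alpha\in T^2}\mathbb{V}^\mu(\alpha)\mu(\alpha)=\sum_{\alpha\in T^2}(\mathbb{I}^*\mu(\alpha))^2,\qquad \mathcal{E}_\delta[\mu]=\sum_{\alpha\in T^2}\mathbb{V}^\mu_\delta(\alpha)\mu(\alpha)=\sum_{\alpha\in E_\delta}(\mathbb{I}^*\mu(\alpha))^2.$$ *)

(* Defs.v *)
From mathcomp Require Import all_boot all_order all_algebra.
From mathcomp Require Import reals.

Set Implicit Arguments.
Unset Strict Implicit.
Unset Printing Implicit Defensive.

Import Order.TTheory GRing.Theory Num.Theory.
Local Open Scope ring_scope.

(* The node (k, j), with k <= N and j < 2 ^ k, stands for the dyadic interval
   [j / 2 ^ k, (j + 1) / 2 ^ k]. *)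
Definition tree (N : nat) : finType := {k : 'I_N.+1 & 'I_(2 ^ k)}.

Definition bitree (N : nat) : finType := (tree N * tree N)%type.

Section Potential.
Variables (R : realType) (N : nat).

Definition dyadic_itv (a : tree N) : interval R :=
  `[(tagged a)%:R / 2 ^+ tag a, (tagged a).+1%:R / 2 ^+ tag a].

(* The order (<=%O) of [interval R] is inclusion of intervals. *)
Definition tree_le (a b : tree N) : bool :=
  (dyadic_itv a <= dyadic_itv b)%O.

Definition bitree_le (a b : bitree N) : bool :=
  tree_le a.1 b.1 && tree_le a.2 b.2.

Implicit Types (f mu : bitree N -> R) (a b : bitree N) (s delta : R).

Definition hardy f a : R := \sum_(b | bitree_le a b) f b.

Definition hardy_adj f a : R := \sum_(b | bitree_le b a) f b.

Definition mass mu : R := \sum_a mu a.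

Definition potential mu : bitree N -> R := hardy (hardy_adj mu).

Definition sublevel mu s : {set bitree N} := [set a | potential mu a <= s].

Definition trunc_potential mu delta : bitree N -> R :=
  hardy (fun a => (a \in sublevel mu delta)%:R * hardy_adj mu a).

Definition energy mu : R := \sum_a potential mu a * mu a.

Definition trunc_energy mu delta : R :=
  \sum_a trunc_potential mu delta a * mu a.

End Potential.

(* Main.v *)
Require Import Defs.
From mathcomp Require Import all_boot all_order all_algebra.
From mathcomp Require Import reals sequences exp.
From mathcomp Require Import ring lra.
Import Order.TTheory GRing.Theory Num.Theory.
Local Open Scope ring_scope.

(* Write w = I^* mu, V = I w, f = 1_(E_d) w, let I_1, I_2 be the Hardy operators
   in one coordinate and let s >= 4 d.  Everything follows from
     E_d[mu] <= 2 s |mu| + 8 (d / s) E_s[mu].                               (1)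
   Fix x = (x1, x2) and split I f x = sum of w p over p = (a, b) >= x, p in E_d.
   The p with V(a, x2) <= s contribute at most s, because the a's form a chain.
   If V(a, x2) > s, then the y in [x2, b] with V(a, y) <= s carry at least s / 2
   of the mass of I_1 w (a, .).  Hence
     I f <= s + (2 / s) I (1_(E_s) (I_2 f) (I_1 w)).
   Two applications of [down_sum_le] on each fibre {a} x T give
     sum over E_s of (I_2 f)^2 (I_1 w)^2 <= 2 s d E_d[mu],
   and integrating against mu and using AM-GM yields (1).
   Iterating (1) n times with s = A d, where A = 4 exp(sqrt L),
   L = log (E[mu] / (d |mu|)) and n = floor (sqrt L) + 1, makes the last term at
   most 8^n d |mu| since A^n >= exp L, while the accumulated constants are
   8^n <= 8 exp(sqrt L * log 8). *)

(** * Sums along chains of a finite forest *)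

(* [le] is a forest order, ancestors being larger: the elements above a given
   one form a chain. *)
Section Forest.
Set Implicit Arguments.
Unset Strict Implicit.
Variables (R : realFieldType) (T : finType) (le : rel T).
Hypothesis leT_refl : reflexive le.
Hypothesis leT_trans : transitive le.
Hypothesis leT_up : forall x y z, le x y -> le x z -> le y z || le z y.

Implicit Types (u v nu : T -> R) (P Q : pred T) (s d : R).

(** Going down the chain above [x], up-sets can only grow, so an element with an up-set of maximal
    size is least. Equality of the two up-sets takes the place of antisymmetry. *)
Lemma up_min x (P : pred T) (a0 : T) : le x a0 -> P a0 ->
  exists2 a, le x a && P a & forall b, le x b -> P b -> le a b.
Proof.
move=> xa0 Pa0.
have h0 : le x a0 && P a0 by rewrite xa0.
case: (@arg_maxnP _ a0 (fun a => le x a && P a) (fun a => #|[set b | le a b]|) h0).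
move=> a /andP[xa Pa] amax; exists a; first by rewrite xa.
move=> b xb Pb; case/orP: (leT_up xa xb) => // ba.
have sub : [set c | le a c] \subset [set c | le b c].
  by apply/subsetP => c; rewrite !inE; apply: leT_trans.
have /eqP eqab : [set c | le a c] == [set c | le b c].
  by rewrite eqEcard sub; apply: amax; rewrite xb.
by have := leT_refl b; move/setP: eqab => /(_ b); rewrite !inE => ->.
Qed.

Lemma up_max x (P : pred T) (a0 : T) : le x a0 -> P a0 ->
  exists2 a, le x a && P a & forall b, le x b -> P b -> le b a.
Proof.
move=> xa0 Pa0.
have h0 : le x a0 && P a0 by rewrite xa0.
case: (@arg_minnP _ a0 (fun a => le x a && P a) (fun a => #|[set b | le a b]|) h0).
move=> a /andP[xa Pa] amin; exists a; first by rewrite xa.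
move=> b xb Pb; case/orP: (leT_up xa xb) => // ab.
have sub : [set c | le b c] \subset [set c | le a c].
  by apply/subsetP => c; rewrite !inE; apply: leT_trans.
have /eqP eqab : [set c | le b c] == [set c | le a c].
  by rewrite eqEcard sub; apply: amin; rewrite xb.
by have := leT_refl a; move/setP: eqab => /(_ a); rewrite !inE => ->.
Qed.

(** All terms on the left lie above the least [a] of the chain that satisfies [P], and the
    hypothesis at this one element bounds them together. *)
Lemma chain_sum_le u P s x : (forall a, 0 <= u a) -> 0 <= s ->
    (forall a, P a -> \sum_(b | le a b) u b <= s) ->
  \sum_(a | le x a && P a) u a <= s.
Proof.
move=> u0 s0 us; case: (pickP (fun a => le x a && P a)) => [a0 /andP[xa0 Pa0]|no].
  have [a /andP[xa Pa] amin] := up_min xa0 Pa0.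
  apply: le_trans (us _ Pa).
  rewrite [leRHS](bigID (fun b => le x b && P b)) /= -[leLHS]addr0.
  apply: lerD; last exact: sumr_ge0.
  rewrite le_eqVlt; apply/orP; left; apply/eqP; apply: eq_bigl => b.
  by apply/idP/idP => [/andP[xb Pb]|/andP[]//]; rewrite amin // xb.
by rewrite big_pred0.
Qed.

(** Any two elements above [x] are comparable, so every product [u a * u b] occurs with [a] below
    [b] or the other way round; this symmetry gives the factor 2. *)
Lemma sqr_chain_sum_le u P x : (forall a, 0 <= u a) ->
  (\sum_(a | le x a && P a) u a) ^+ 2 <=
  2 * \sum_(a | le x a) (P a)%:R * (u a * \sum_(b | le a b && P b) u b).
Proof.
move=> u0.
pose W a b := ((P a && P b)%:R * (u a * u b)) : R.
have W0 a b : 0 <= W a b by rewrite !mulr_ge0.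
have -> : (\sum_(a | le x a && P a) u a) ^+ 2 =
    \sum_(a | le x a) \sum_(b | le x b) W a b.
  rewrite expr2 mulr_suml big_mkcondr; apply: eq_bigr => a xa.
  case: ifP => Pa.
    rewrite mulr_sumr big_mkcondr; apply: eq_bigr => b xb.
    by rewrite /W Pa; case: ifP => _; rewrite ?mul1r ?mul0r.
  by rewrite big1 // => b _; rewrite /W Pa mul0r.
have eqS a : (P a)%:R * (u a * \sum_(b | le a b && P b) u b) =
    \sum_(b | le a b) W a b.
  rewrite mulrA mulr_sumr big_mkcondr; apply: eq_bigr => b _.
  by rewrite /W; case: (P a); case: (P b); rewrite ?mul1r ?mul0r ?mulr0.
rewrite (eq_bigr _ (fun a _ => eqS a)).
have leS : \sum_(a | le x a) \sum_(b | le x b) W a b <=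
  \sum_(a | le x a) \sum_(b | le x b) ((le a b)%:R * W a b + (le b a)%:R * W b a).
  apply: ler_sum => a xa; apply: ler_sum => b xb.
  have -> : W b a = W a b by rewrite /W andbC [u b * _]mulrC.
  have := leT_up xa xb; have := W0 a b.
  by case: (le a b); case: (le b a) => //= h _; rewrite ?mul1r ?mul0r ?addr0 ?add0r ?lerDl.
apply: le_trans leS _.
rewrite (eq_bigr _ (fun a _ => big_split _ _ _ _ _)) big_split /=
  [X in _ + X]exchange_big /=.
rewrite -mulr2n -[leLHS]mulr_natl.
rewrite ler_pM2l // ?ltr0n //; apply: ler_sum => a xa.
rewrite le_eqVlt; apply/orP; left; apply/eqP.
rewrite [RHS]big_mkcond [LHS]big_mkcond; apply: eq_bigr => b _.
case: (boolP (le a b)) => ab; last by rewrite mul0r if_same.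
by rewrite mul1r (leT_trans xa ab).
Qed.

(** After exchanging the sums, the coefficient of [nu x] is a sum of [u] over part of the chain
    above [x], which [chain_sum_le] bounds by [s]. *)
Lemma down_sum_le u nu P s c : (forall a, 0 <= u a) -> (forall a, 0 <= nu a) ->
    0 <= s -> (forall a, P a -> \sum_(b | le a b) u b <= s) ->
  \sum_(a | le a c && P a) u a * \sum_(x | le x a) nu x <=
  s * \sum_(x | le x c) nu x.
Proof.
move=> u0 nu0 s0 us.
under eq_bigr => a _ do rewrite mulr_sumr.
rewrite (exchange_big_dep (fun x => le x c)) /=; last first.
  by move=> a x /andP[ac _] xa; apply: leT_trans xa ac.
rewrite mulr_sumr; apply: ler_sum => x xc.
rewrite -mulr_suml; apply: ler_wpM2r => //.
apply: le_trans (chain_sum_le x u0 s0 us).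
rewrite big_mkcond [leRHS]big_mkcond; apply: ler_sum => a _.
by case: (le a c); case: (P a); case: (le x a) => //=.
Qed.

(* Expand the square along the chain, then use [down_sum_le] once with [Q] and
   [nu1], once with [P] and [nu2]. *)
Lemma chain_sqr_sum_le (nu1 nu2 u w : T -> R) P Q (d s : R) :
    (forall x, 0 <= nu1 x) -> (forall x, 0 <= nu2 x) -> 0 <= d -> 0 <= s ->
    (forall a, u a = \sum_(x | le x a) nu1 x) ->
    (forall a, w a = \sum_(x | le x a) nu2 x) ->
    (forall a, P a -> \sum_(b | le a b) u b <= d) ->
    (forall a, Q a -> \sum_(b | le a b) u b <= s) ->
  \sum_(b | Q b) (\sum_(c | le b c && P c) w c) ^+ 2 * u b ^+ 2 <=
  2 * (s * d) * \sum_(b | P b) w b ^+ 2.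
Proof.
move=> nu10 nu20 d0 s0 uE wE Pd Qs.
have u0 a : 0 <= u a by rewrite uE sumr_ge0.
have w0 a : 0 <= w a by rewrite wE sumr_ge0.
pose H c := (P c)%:R * (w c * \sum_(b | le c b && P b) w b).
have H0 c : 0 <= H c by rewrite !mulr_ge0 // sumr_ge0.
have step1 : \sum_(b | Q b) (\sum_(c | le b c && P c) w c) ^+ 2 * u b ^+ 2 <=
    2 * \sum_c H c * (s * u c).
  apply: (@le_trans _ _
      (\sum_(b | Q b) (2 * \sum_(c | le b c) H c) * u b ^+ 2)).
    by apply: ler_sum => b _; rewrite ler_wpM2r ?sqr_ge0 // sqr_chain_sum_le.
  under eq_bigr => b _ do rewrite -mulrA.
  rewrite -mulr_sumr ler_pM2l ?ltr0n //.
  under eq_bigr => b _ do rewrite mulr_suml.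
  rewrite (exchange_big_dep predT) //=; apply: ler_sum => c _.
  rewrite -mulr_sumr; apply: ler_wpM2l => //.
  rewrite [in leRHS]uE; apply: le_trans (down_sum_le c u0 nu10 s0 Qs).
  rewrite le_eqVlt; apply/orP; left; apply/eqP.
  by apply: eq_big => [b|b _]; rewrite 1?andbC // -uE expr2.
apply: le_trans step1 _.
rewrite -!mulrA ler_pM2l ?ltr0n //.
under eq_bigr => c _ do rewrite mulrCA.
rewrite -mulr_sumr ler_wpM2l //.
rewrite (_ : \sum_c H c * u c = \sum_(b | P b) w b *
     \sum_(c | le c b && P c) u c * w c); last first.
  rewrite (eq_bigr (fun c => \sum_(b | le c b && P b)
      (P c)%:R * (w b * (u c * w c)))); last first.
    by move=> c _; rewrite /H !mulr_sumr mulr_suml; apply: eq_bigr => b _; ring.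
  rewrite (exchange_big_dep P) /=; last by move=> ? ? _ /andP[].
  apply: eq_bigr => b Pb; rewrite mulr_sumr.
  rewrite [RHS]big_mkcondr [LHS]big_mkcondr; rewrite Pb /=.
  by apply: eq_bigr => c _; case: (P c); rewrite ?mul1r ?mul0r.
rewrite mulr_sumr; apply: ler_sum => b Pb.
rewrite expr2 mulrCA ler_wpM2l // [in leRHS]wE.
apply: le_trans (down_sum_le b u0 nu20 d0 Pd).
rewrite le_eqVlt; apply/orP; left; apply/eqP.
by apply: eq_bigr => c _; rewrite wE.
Qed.

(* For [c] maximal above [x] with potential > s, the chain above [c] splits into
   [c] itself (at most u b <= d), the part above [b] (at most d), and the rest. *)
Lemma chain_sum_ge u (d s : R) x b : antisymmetric le ->
    (forall a, 0 <= u a) -> {homo u : y z / le y z >-> y <= z} -> d <= s ->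
    s < \sum_(z | le x z) u z -> le x b -> \sum_(z | le b z) u z <= d ->
  s <= d *+ 2 +
    \sum_(y | le x y && le y b && (\sum_(z | le y z) u z <= s)) u y.
Proof.
move=> leT_anti u0 umono ds sx xb bd.
have [c /andP[xc sc] cmax] :=
  up_max (P := fun y => s < \sum_(z | le y z) u z) (leT_refl x) sx.
have sum_anti y z : le y z -> \sum_(t | le z t) u t <= \sum_(t | le y t) u t.
  move=> yz; rewrite big_mkcond [leRHS]big_mkcond; apply: ler_sum => t _.
  by case: ifP => [zt|_]; [rewrite (leT_trans yz zt)|case: ifP].
have cb : le c b.
  case/orP: (leT_up xc xb) => // bc.
  by have := le_lt_trans (le_trans (le_trans (sum_anti _ _ bc) bd) ds) sc; rewrite ltxx.
have ucd : u c <= d.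
  apply: le_trans (umono _ _ cb) (le_trans _ bd).
  by rewrite (bigD1 b) //= lerDl sumr_ge0.
apply: le_trans (ltW sc) _.
rewrite (bigD1 c) //= mulr2n -addrA; apply: lerD => //.
apply: (le_trans _ (lerD bd (lexx _))).
rewrite big_mkcond [X in _ <= X + _]big_mkcond [X in _ <= _ + X]big_mkcond -big_split.
apply: ler_sum => z _ /=; case: ifP => [/andP[cz zc]|_].
  have xz := leT_trans xc cz; rewrite xz /=.
  have -> : \sum_(t | le z t) u t <= s.
    rewrite leNgt; apply/negP => /(cmax _ xz) zc'.
    by move: zc; rewrite (leT_anti z c) ?eqxx // zc' cz.
  case/orP: (leT_up xb xz) => ->; first by rewrite lerDl; case: ifP.
  by rewrite lerDr; case: ifP.
by apply: addr_ge0; case: ifP.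
Qed.

End Forest.

(** * Dyadic intervals form a forest under inclusion *)

Section DyadicTree.
Set Implicit Arguments.
Unset Strict Implicit.
Variables (R : realType) (N : nat).
Implicit Types (a b c : tree N).

Lemma tree_leE a b : tree_le R a b =
  ((tagged b)%:R / 2 ^+ tag b <= (tagged a)%:R / 2 ^+ tag a :> R) &&
  ((tagged a).+1%:R / 2 ^+ tag a <= (tagged b).+1%:R / 2 ^+ tag b :> R).
Proof. by rewrite /tree_le subitvE !bnd_simp. Qed.

Lemma tree_le_refl : reflexive (tree_le R (N := N)).
Proof. by move=> a; rewrite /tree_le lexx. Qed.

Lemma tree_le_trans : transitive (tree_le R (N := N)).
Proof. by move=> b a c; apply: le_trans. Qed.

Lemma dyadic_lt_right a :
  (tagged a)%:R / 2 ^+ tag a < (tagged a).+1%:R / 2 ^+ tag a :> R.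
Proof. by rewrite ltr_pM2r ?ltr_nat // invr_gt0 exprn_gt0. Qed.

(** Equal intervals have the same length, which determines the level; then the left endpoint
    determines the index. *)
Lemma tree_le_anti : antisymmetric (tree_le R (N := N)).
Proof.
move=> a b /le_anti []; case: a b => [i x] [j y] /= exy exy'.
have p k : (2 ^+ k : R) != 0 by rewrite expf_neq0 ?pnatr_eq0.
have eij : i = j.
  apply/val_inj/eqP; rewrite -(eqn_exp2l _ _ (isT : 1 < 2)%N) -(eqr_nat R).
  rewrite !natrX; apply/eqP/invr_inj.
  have : x.+1%:R / 2 ^+ i - x%:R / 2 ^+ i = y.+1%:R / 2 ^+ j - y%:R / 2 ^+ j :> R.
    by rewrite exy exy'.
  by rewrite -!mulrBl -!natrB // !subSnn !mul1r.
move: y exy {exy'}; rewrite -eij => y /(mulIf _) exy.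
congr existT; apply/val_inj/eqP; rewrite -(eqr_nat R); apply/eqP/exy.
by rewrite invr_eq0.
Qed.

(** Over the finer denominator [2 ^ tag c] all endpoints of [b] and [c] have integer numerators.
    Both intervals contain [a], which has positive length, so they do not merely share an endpoint;
    the resulting strict integer inequalities say that [c] lies inside [b]. *)
Lemma tree_le_up_aux a b c : (tag b <= tag c)%N ->
  tree_le R a b -> tree_le R a c -> tree_le R c b.
Proof.
rewrite !tree_leE => bc /andP[ab ab'] /andP[ac ac'].
have lr := dyadic_lt_right a.
case: a b c bc ab ab' ac ac' lr => [i x] [j y] [k z] /= jk ab ab' ac ac' lr.
have pk n : 0 < (2 ^+ n : R) by rewrite exprn_gt0.
have e m : m%:R / 2 ^+ j = (m * 2 ^ (k - j))%:R / 2 ^+ k :> R.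
  apply/eqP; rewrite eqr_div ?(lt0r_neq0 (pk _)) // -!natrX -!natrM eqr_nat -mulnA -expnD.
  by rewrite subnK.
move: ab ab'; rewrite !e => ab ab'.
rewrite !ler_pM2r ?invr_gt0 // !ler_nat.
have : (z%:R / 2 ^+ k < (y.+1 * 2 ^ (k - j))%:R / 2 ^+ k :> R).
  by apply: le_lt_trans ac _; apply: lt_le_trans lr _.
have : ((y * 2 ^ (k - j))%:R / 2 ^+ k < z.+1%:R / 2 ^+ k :> R).
  by apply: le_lt_trans ab _; apply: lt_le_trans lr _.
by rewrite !ltr_pM2r ?invr_gt0 // !ltr_nat ltnS => -> ->.
Qed.

Lemma tree_le_up a b c :
  tree_le R a b -> tree_le R a c -> tree_le R b c || tree_le R c b.
Proof.
move=> ab ac; have [bc|/ltnW cb] := leqP (tag b) (tag c).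
  by rewrite (tree_le_up_aux bc ab ac) orbT.
by rewrite (tree_le_up_aux cb ac ab).
Qed.

End DyadicTree.

(** * Potentials and energies on the bi-tree *)

Section Bitree.
Set Implicit Arguments.
Unset Strict Implicit.
Variables (R : realType) (N : nat) (mu : bitree N -> R).
Hypothesis mu0 : forall a, 0 <= mu a.
Local Notation le := (tree_le R (N := N)).
Local Notation w := (hardy_adj mu).
Local Notation E := (sublevel mu).
Implicit Types (f : bitree N -> R) (p : bitree N) (a b x y : tree N).

Lemma hardyE f a b :
  hardy f (a, b) = \sum_(x | le a x) \sum_(y | le b y) f (x, y).
Proof. by rewrite pair_big; apply: eq_big => [[x y]|[x y] _]. Qed.

Lemma hardy_adjE f a b :
  hardy_adj f (a, b) = \sum_(x | le x a) \sum_(y | le y b) f (x, y).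
Proof. by rewrite pair_big; apply: eq_big => [[x y]|[x y] _]. Qed.

(** Duality of the Hardy operator and its adjoint. *)
Lemma sum_hardy_mul f : \sum_p hardy f p * mu p = \sum_p f p * w p.
Proof.
under eq_bigr => p _ do rewrite mulr_suml.
rewrite (exchange_big_dep predT) //=.
by apply: eq_bigr => p _; rewrite mulr_sumr.
Qed.

Lemma hardy_adj_ge0 p : 0 <= w p.
Proof. exact: sumr_ge0. Qed.

Lemma hardy_adj_homo p q : bitree_le R p q -> w p <= w q.
Proof.
case: p q => [a b] [a' b'] /andP[/= aa' bb'].
rewrite /hardy_adj big_mkcond [leRHS]big_mkcond; apply: ler_sum => -[x y] _.
case: ifP => [/andP[/= xa yb]|_]; last by case: ifP.
by rewrite /bitree_le /= (tree_le_trans xa aa') (tree_le_trans yb bb').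
Qed.

Lemma trunc_energyE s : trunc_energy mu s = \sum_(p in E s) w p ^+ 2.
Proof.
rewrite /trunc_energy sum_hardy_mul [RHS]big_mkcond.
by apply: eq_bigr => p _; case: ifP => _; rewrite ?mul0r // mul1r expr2.
Qed.

Lemma trunc_energy_le s : trunc_energy mu s <= energy mu.
Proof.
rewrite trunc_energyE /energy sum_hardy_mul big_mkcond.
by apply: ler_sum => p _; rewrite -expr2; case: ifP; rewrite ?sqr_ge0.
Qed.

(* These are I_1 (I^* mu) and I_2 (1_(E_d) I^* mu). *)
Definition row_pot (p : bitree N) : R := \sum_(x | le p.1 x) w (x, p.2).

Definition col_pot (d : R) (p : bitree N) : R :=
  \sum_(y | le p.2 y && ((p.1, y) \in E d)) w (p.1, y).

Lemma row_pot_ge0 p : 0 <= row_pot p.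
Proof. by apply: sumr_ge0 => x _; apply: hardy_adj_ge0. Qed.

(** On a fibre with [a] fixed, the potential is a chain sum in one tree, so the forest lemmas apply
    with [row_pot] as [u]. *)
Lemma potentialE a b : potential mu (a, b) = \sum_(y | le b y) row_pot (a, y).
Proof. by rewrite /potential hardyE exchange_big. Qed.

(** * Inequality (1) and its iteration *)

Lemma trunc_potential_le (d s : R) p : 0 < d -> 4 * d <= s ->
  trunc_potential mu d p <=
  s + 2 / s * hardy (fun q => (q \in E s)%:R * (col_pot d q * row_pot q)) p.
Proof.
case: p => [x1 x2] d0 ds; rewrite /trunc_potential !hardyE.
have s0 : 0 < s by lra.
rewrite (bigID (fun a => potential mu (a, x2) <= s)) /=; apply: lerD.
  pose u a := \sum_(b | le x2 b) w (a, b).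
  have u0 a : 0 <= u a by apply: sumr_ge0 => b _; apply: hardy_adj_ge0.
  apply: (@le_trans _ _ (\sum_(a | le x1 a && (potential mu (a, x2) <= s)) u a)).
    apply: ler_sum => a _; apply: ler_sum => b _.
    by case: (_ \in _); rewrite ?mul1r // mul0r hardy_adj_ge0.
  apply: (@chain_sum_le _ _ _ (@tree_le_refl R N) (@tree_le_trans R N)
    (@tree_le_up R N)) => //; first exact: ltW.
  by move=> a; rewrite /potential hardyE.
have g0 a b : 0 <= ((a, b) \in E s)%:R * (col_pot d (a, b) * row_pot (a, b)).
  rewrite !mulr_ge0 ?row_pot_ge0 ?ler0n //.
  by apply: sumr_ge0 => y _; apply: hardy_adj_ge0.
rewrite mulr_sumr [leRHS](bigID (fun a => potential mu (a, x2) <= s)) /=.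
rewrite -[leLHS]add0r; apply: lerD.
  apply: sumr_ge0 => a _; apply: mulr_ge0; last by apply: sumr_ge0.
  by rewrite divr_ge0 ?ler0n // ltW.
apply: ler_sum => a /andP[_]; rewrite -ltNge => sa.
have step b : le x2 b -> (a, b) \in E d ->
    s / 2 <= \sum_(y | le x2 y && le y b && ((a, y) \in E s)) row_pot (a, y).
  move=> x2b; rewrite inE potentialE => bd; rewrite potentialE in sa.
  have mono : {homo (fun y => row_pot (a, y)) : y z / le y z >-> y <= z}.
    move=> y z yz; apply: ler_sum => t _; apply: hardy_adj_homo.
    by rewrite /bitree_le /= tree_le_refl yz.
  have dles : d <= s by lra.
  (* This loses [2 * d], at most [s / 2] because [4 * d <= s]. *)
  have := chain_sum_ge (@tree_le_refl R N) (@tree_le_trans R N) (@tree_le_up R N)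
    (@tree_le_anti R N) (fun y => row_pot_ge0 (a, y)) mono dles sa x2b bd.
  have -> : \sum_(y | le x2 y && le y b && ((a, y) \in E s)) row_pot (a, y) =
      \sum_(y | le x2 y && le y b && (\sum_(z | le y z) row_pot (a, z) <= s))
         row_pot (a, y).
    by apply: eq_bigl => y; rewrite inE potentialE.
  rewrite mulr2n; lra.
rewrite -(ler_pM2l (_ : 0 < s / 2)); last by lra.
rewrite mulrA (_ : s / 2 * (2 / s) = 1); last by field; rewrite gt_eqF.
rewrite mul1r mulr_sumr.
(* Expanding [col_pot] and exchanging the sums sets each [w (a, b)] against the sum of [row_pot]
   over the [y] between [x2] and [b], to which [step] applies. *)
rewrite [leRHS](eq_bigr (fun y => \sum_(b | le x2 b && (le y b && ((a, b) \in E d)))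
    w (a, b) * (((a, y) \in E s)%:R * row_pot (a, y)))); last first.
  move=> y x2y; rewrite mulrCA /col_pot mulr_suml.
  apply: eq_big => // b /=.
  by case: (boolP (le y b)) => [/(tree_le_trans x2y)->|]//; rewrite andbF.
rewrite [leRHS](exchange_big_dep (le x2)) /=; last by move=> ? ? _ /andP[].
apply: ler_sum => b x2b; case: (boolP ((a, b) \in E d)) => abd; last first.
  rewrite mul0r mulr0; apply: sumr_ge0 => y _.
  by rewrite !mulr_ge0 ?ler0n ?row_pot_ge0 ?hardy_adj_ge0.
rewrite mul1r mulrC -mulr_sumr; apply: ler_wpM2l; first exact: hardy_adj_ge0.
apply: le_trans (step b x2b abd) _.
rewrite le_eqVlt; apply/orP; left; apply/eqP.
rewrite big_mkcondr; apply: eq_big => [y|y _]; first by rewrite x2b andbT.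
by case: ifP; rewrite ?mul1r ?mul0r.
Qed.

Lemma sum_sqr_row_col_le (d s : R) : 0 <= d -> 0 <= s ->
  \sum_(p in E s) (col_pot d p * row_pot p) ^+ 2 <=
  2 * (s * d) * trunc_energy mu d.
Proof.
move=> d0 s0; rewrite trunc_energyE.
have pairE (P : pred (bitree N)) f :
    \sum_(p | P p) f p = \sum_a \sum_(b | P (a, b)) f (a, b).
  by rewrite pair_big_dep; apply: eq_big => [[]|[]].
rewrite !pairE mulr_sumr; apply: ler_sum => a _.
under eq_bigr => b _ do rewrite exprMn.
(* On the fibre over [a], [row_pot] and [w] are adjoint Hardy sums, in the second coordinate, of the
   two measures given here. *)
apply: (@chain_sqr_sum_le _ _ _ (@tree_le_refl R N) (@tree_le_trans R N)
  (@tree_le_up R N)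
  (fun y => \sum_(x' | le a x') \sum_(x | le x x') mu (x, y))
  (fun y => \sum_(x | le x a) mu (x, y))
  (fun b => row_pot (a, b)) (fun b => w (a, b))
  (fun b => (a, b) \in E d) (fun b => (a, b) \in E s)) => //.
- by move=> x; do 2!apply: sumr_ge0 => ? _.
- by move=> x; apply: sumr_ge0.
- move=> b; rewrite exchange_big; apply: eq_bigr => x' _ /=.
  by rewrite hardy_adjE exchange_big.
- by move=> b; rewrite hardy_adjE exchange_big.
- by move=> b; rewrite inE potentialE.
- by move=> b; rewrite inE potentialE.
Qed.

Lemma trunc_energy_step (d s : R) : 0 < d -> 4 * d <= s ->
  trunc_energy mu d <= 2 * s * mass mu + 8 * (d / s) * trunc_energy mu s.
Proof.
move=> d0 ds; have s0 : 0 < s by lra.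
pose g q := (q \in E s)%:R * (col_pot d q * row_pot q).
have le1 : trunc_energy mu d <= s * mass mu + 2 / s * \sum_p g p * w p.
  rewrite -sum_hardy_mul /mass !mulr_sumr -big_split; apply: ler_sum => p _ /=.
  by rewrite mulrA -mulrDl ler_wpM2r // trunc_potential_le.
(* The AM-GM weight [4 * s * d] is chosen so that [sum_sqr_row_col_le] turns the square term into
   half of the left side, which is absorbed; this doubles the other constants. *)
have le2 : 2 / s * \sum_p g p * w p <=
    (4 * s * d)^-1 * (\sum_(p in E s) (col_pot d p * row_pot p) ^+ 2) +
    4 * (d / s) * trunc_energy mu s.
  rewrite trunc_energyE !mulr_sumr -big_split [leRHS]big_mkcond /=.
  apply: ler_sum => p _; rewrite /g; case: ifP => _; last by rewrite !mul0r mulr0.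
  set X := col_pot d p * row_pot p; set W := w p; rewrite mul1r -subr_ge0.
  rewrite (_ : _ - _ = (4 * s * d)^-1 * (X - 4 * d * W) ^+ 2); last first.
    by field; rewrite !gt_eqF.
  by rewrite mulr_ge0 ?sqr_ge0 // invr_ge0 !mulr_ge0 // ltW.
have le3 : (4 * s * d)^-1 * (\sum_(p in E s) (col_pot d p * row_pot p) ^+ 2) <=
    trunc_energy mu d / 2.
  have sd0 : 0 < 4 * s * d by rewrite !mulr_gt0.
  rewrite -(ler_pM2l sd0) mulrA mulfV ?gt_eqF // mul1r.
  apply: le_trans (sum_sqr_row_col_le (ltW d0) (ltW s0)) _.
  by rewrite le_eqVlt; apply/orP; left; apply/eqP; field.
lra.
Qed.

(** Passing from [d] to [A * d] costs a factor [A] in the mass term, which cancels against [8 / A],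
    so these terms grow only like powers of 8. Subtracting 1 from [8 ^ n] closes the induction,
    since [1 + (8 ^ n.+1 - 8) <= 8 ^ n.+1 - 1]. *)
Lemma trunc_energy_iter (A : R) n (d : R) : 4 <= A -> 0 < d ->
  trunc_energy mu d <=
  2 * A * d * (8 ^+ n - 1) * mass mu + (8 / A) ^+ n * trunc_energy mu (A ^+ n * d).
Proof.
move=> A4; have A0 : 0 < A by lra.
have m0 : 0 <= mass mu by apply: sumr_ge0.
elim: n d => [|n IHn] d d0; first by rewrite !expr0 subrr !mulr0 mul0r add0r !mul1r.
have Ad0 : 0 < A * d by rewrite mulr_gt0.
have Ad4 : 4 * d <= A * d by rewrite ler_pM2r.
apply: le_trans (trunc_energy_step d0 Ad4) _.
have -> : 8 * (d / (A * d)) = 8 / A by field; rewrite !gt_eqF.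
have A80 : 0 <= 8 / A by rewrite divr_ge0 // ltW.
have := ler_wpM2l A80 (IHn _ Ad0); rewrite mulrDr.
rewrite [_ / _ * (_ * mass mu)](_ : _ = 2 * A * d * (8 ^+ n.+1 - 8) * mass mu); last first.
  by rewrite exprS; field; rewrite gt_eqF.
rewrite [8 / A * (_ * trunc_energy _ _)]mulrA -exprS [A ^+ n * _]mulrA -exprSr.
have : 0 <= A * d * mass mu by rewrite mulr_ge0 // ltW.
set m := A * d * mass mu.
have mE t : 2 * A * d * t * mass mu = 2 * m * t by rewrite /m; ring.
rewrite !mE (_ : 2 * (A * d) * mass mu = 2 * m); last by rewrite /m; ring.
lra.
Qed.

End Bitree.

(** * Choice of the parameters *)

Theorem theorem5p1 (R : realType) :
  exists C c : R,
    forall (N : nat) (mu : bitree N -> R) (delta : R),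
      (forall a, 0 <= mu a) ->
      0 < mass mu ->
      0 < delta ->
      2 * delta * mass mu <= energy mu ->
      trunc_energy mu delta <=
        C * delta
          * expR (c * Num.sqrt (ln (energy mu / (delta * mass mu))))
          * mass mu.
Proof.
(* 72 is 9 times 8: the 9 is 8 from [2 * A] and 1 from the tail, the other 8 comes from rounding [s]
   up to [n]. In the exponent, 1 comes from [A] and [ln 8] from [8 ^ n]. *)
exists 72, (1 + ln 8) => N mu d mu0 m0 d0 dE.
have dm0 : 0 < d * mass mu by rewrite mulr_gt0.
set s := Num.sqrt _.
(* This makes the logarithm non-negative, so [Num.sqrt] does not take its default value 0 on a
   negative argument. *)
have X1 : 1 <= energy mu / (d * mass mu).
  by rewrite ler_pdivlMr // mul1r; lra.
have s0 : 0 <= s := sqrtr_ge0 _.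
have ss : energy mu = expR (s * s) * (d * mass mu).
  rewrite -expr2 sqr_sqrtr ?ln_ge0 // lnK ?posrE; last exact: lt_le_trans X1.
  by rewrite divfK // gt_eqF.
have [n sn ns] : exists2 n, s <= n%:R & n%:R <= 1 + s.
  have /andP[n1 n2] := truncn_itv s0.
  by exists (Num.truncn s).+1; [apply: ltW|rewrite -nat1r lerD2l].
pose A := 4 * expR s.
have A4 : 4 <= A by rewrite /A ler_peMr // -expR0 ler_expR.
have A0 : 0 < A by lra.
have ln8 : 0 <= ln 8 :> R by rewrite ln_ge0 // ler1n.
have en8 : 8 ^+ n <= 8 * expR (ln 8 * s) :> R.
  have e8 : 8 = expR (ln 8) :> R by rewrite lnK // posrE.
  rewrite {1 2}e8 -expRM_natl -expRD ler_expR.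
  by rewrite mulrC -[X in X + _]mulr1 -mulrDr ler_wpM2l.
(* Since [s <= n], [A ^+ n] is at least [expR (s * s)], the ratio of the energy to [d * mass mu]. *)
have tail : (8 / A) ^+ n * trunc_energy mu (A ^+ n * d) <= 8 ^+ n * (d * mass mu).
  rewrite expr_div_n -mulrA ler_wpM2l ?exprn_ge0 // ler_pdivrMl ?exprn_gt0 //.
  apply: le_trans (trunc_energy_le mu _) _; rewrite ss ler_pM2r //.
  rewrite /A exprMn -expRM_natl -[leLHS]mul1r ler_pM ?expR_ge0 //.
    by rewrite exprn_ege1 // ler1n.
  by rewrite ler_expR ler_wpM2r.
apply: le_trans (trunc_energy_iter mu0 n A4 d0) _.
apply: (@le_trans _ _ ((9 * expR s) * 8 ^+ n * (d * mass mu))).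
  apply: le_trans (lerD (lexx _) tail) _.
  have e1 : 1 <= expR s by rewrite -expR0 ler_expR.
  rewrite (_ : 2 * A * d * (8 ^+ n - 1) * mass mu =
     8 * expR s * (8 ^+ n - 1) * (d * mass mu)); last by rewrite /A; ring.
  rewrite -mulrDl ler_pM2r //.
  have : 0 <= (8 ^+ n : R) by rewrite exprn_ge0.
  set t := 8 ^+ n => t0; have := ler_peMl t0 e1; lra.
rewrite [(1 + ln 8) * s]mulrDl mul1r expRD.
rewrite (_ : 72 * d * _ * _ = (9 * expR s) * (8 * expR (ln 8 * s)) * (d * mass mu)); last by ring.
by rewrite ler_pM2r // ler_pM2l // mulr_gt0 // expR_gt0.
Qed.
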